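(* Let $\Gamma$ be a discrete group. (1) Let $p\in[1,\infty)$ with $p\ne2$. A completely unconditional set in $\mathrm L^p$ cannot contain the sumset of two arbitrarily large sets; that is, if $\Lambda\subseteq\Gamma$ is completely unconditional in $\mathrm L^p$, there is an integer $N$ such that $RC\not\subseteq\Lambda$ for all $R,C\subseteq\Gamma$ with $\#R\ge N$ and $\#C\ge N$. (2) More precisely, let $n\ge1$ and let $R$ and $C$ be subsets of $\Gamma$ with $\#R\ge n$ and $\#C\ge n^3$. Then, for any $p\in[1,\infty)$, the complete unconditional constant of the sumset $RC$ in $\mathrm L^p$ is at least $n^{|1/2-1/p|}$.
   Context: $RC=\{rc:r\in R,\,c\in C\}$ is called the sumset of $R$ and $C$. $\lambda_\gamma$ ($\gamma\in\Gamma$) are the left translations on $\ell^2_\Gamma$, $\lambda_\gamma\mathrm e_\beta=\mathrm e_{\gamma\beta}$; $\mathrm L^\infty$ is the von Neumann algebra they generate, with trace $\tau(x)=x_{\epsilon,\epsilon}$ ($\epsilon$ the identity of $\Gamma$); $\mathrm L^p$ is the noncommutative Lebesgue space of $(\mathrm L^\infty,\tau)$ and $\mathrm L^p(\operatorname{tr}\otimes\tau)$ that of $\mathbb B(\ell^2)\otimes\mathrm L^\infty$. $\mathrm L^p_\Lambda(\operatorname{tr}\otimes\tau)$ is the closed span of $x\otimes\lambda_\gamma$ with $x$ in the Schatten class $\mathrm S^p$ of $\ell^2$ and $\gamma\in\Lambda$; its elements $x$ have Fourier series $\sum_{\gamma\in\Lambda}x_\gamma\otimes\lambda_\gamma$ with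 $x_\gamma\in\mathrm S^p$. $\Lambda\subseteq\Gamma$ is completely unconditional in $\mathrm L^p$ if there is a constant $D$ such that $\|\sum_{\gamma\in\Lambda'}x_\gamma\otimes\varepsilon_\gamma\lambda_\gamma\|\le D\|x\|$ for all $x\in\mathrm L^p_\Lambda(\operatorname{tr}\otimes\tau)$, finite $\Lambda'\subseteq\Lambda$ and $\varepsilon_\gamma\in\mathbb C$ with $|\varepsilon_\gamma|=1$. The minimal such $D$ ($\infty$ if there is none) is the complete unconditional constant of $\Lambda$ in $\mathrm L^p$. *)

(* Defs.v *)
From HB Require Import structures.
From mathcomp Require Import all_boot all_order all_algebra finmap complex.
From mathcomp Require Import all_classical all_reals all_analysis.
From mathcomp Require summability.

Set Implicit Arguments.
Unset Strict Implicit.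
Unset Printing Implicit Defensive.

Import Order.TTheory GRing.Theory Num.Theory.
Import numFieldNormedType.Exports.

Local Open Scope classical_set_scope.
Local Open Scope ring_scope.
Local Open Scope complex_scope.

(* A bounded operator x on the Hilbert space l^2(I) is represented by its
   matrix x i j = <x e_j, e_i> in the canonical basis, so that the bounded
   operators are the matrices x with [bounded_op x]. *)
Section Operators.
Variables (R : realType) (I : choiceType).
Implicit Types (x y a b : I -> I -> R[i]) (S : set (I -> I -> R[i])).

(* The entries of a product are unordered sums over I; they converge
   absolutely for bounded operators. *)
Definition op_mul x y : I -> I -> R[i] :=
  fun i j => summability.sum (fun k => x i k * y k j : R[i]^o).

Definition op_one : I -> I -> R[i] := fun i j => (i == j)%:R.

Definition op_adj x : I -> I -> R[i] := fun i j => (x j i)^*.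

Definition op_exp x (n : nat) : I -> I -> R[i] := iter n (op_mul x) op_one.

Definition op_horner (q : {poly R}) x : I -> I -> R[i] :=
  \sum_(k < size q) (q`_k)%:C *: op_exp x k.

(* The operator norm: the supremum of |<x u, v>| over the finitely supported
   vectors u and v (given by their values on a finite set F) of norm <= 1. *)
Definition opnorm x : \bar R :=
  ereal_sup [set z | exists (F : {fset I}) (u v : I -> R[i]),
    [/\ \sum_(i <- F) `|u i| ^+ 2 <= 1,
        \sum_(i <- F) `|v i| ^+ 2 <= 1 &
        z = (complex.Re
               `|\sum_(i <- F) \sum_(j <- F) (v i)^* * x i j * u j|)%:E]].

Definition bounded_op : set (I -> I -> R[i]) :=
  [set x | (opnorm x < +oo)%E].

Definition commutant S : set (I -> I -> R[i]) :=
  [set y | bounded_op y /\ forall x, S x -> op_mul x y = op_mul y x].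

(* The von Neumann algebra generated by a self-adjoint set S containing 1. *)
Definition vN S : set (I -> I -> R[i]) := commutant (commutant S).

(* Continuous functional calculus for a positive bounded operator a: b = f(a)
   is the limit in operator norm of q_n(a) for polynomials q_n converging to f
   uniformly on an interval [0, M] with M >= ||a||, hence on the spectrum
   of a. *)
Definition is_fun_calc (f : R -> R) a b : Prop :=
  exists (M : R) (q : nat -> {poly R}),
    (opnorm a <= M%:E)%E /\
    forall e : R, 0 < e -> \forall n \near \oo,
      (forall t, 0 <= t <= M -> `|(q n).[t] - f t| <= e) /\
      (opnorm (op_horner (q n) a - b)%R <= e%:E)%E.

(* |x|^p = (x^* x)^(p/2). For bounded x and p > 0 there is exactly one such
   operator. *)
Definition abs_pow (p : R) x : I -> I -> R[i] :=
  xget 0 [set b | is_fun_calc (fun t => t `^ (p / 2)) (op_mul (op_adj x) x) b].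

(* The sum of the diagonal entries indexed by D of a positive operator. *)
Definition diag_trace (D : set I) b : \bar R :=
  \esum_(i in D) (complex.Re (b i i))%:E.

(* ||x||_p = tau(|x|^p)^(1/p), where tau = diag_trace D. *)
Definition Lp_norm (D : set I) (p : R) x : \bar R :=
  (diag_trace D (abs_pow p x) `^ p^-1)%E.

End Operators.

Section Schatten.
Variable R : realType.

Definition Sp (p : R) : set (nat -> nat -> R[i]) :=
  [set x | bounded_op x /\ (Lp_norm setT p x < +oo)%E].

End Schatten.

Section Tensor.
Variables (R : realType) (I J : choiceType).

(* l^2(I) (x) l^2(J) is identified with l^2(I * J). *)
Definition tens (a : I -> I -> R[i]) (b : J -> J -> R[i]) :
    I * J -> I * J -> R[i] :=
  fun s t => a s.1 t.1 * b s.2 t.2.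

Definition vN_tens (A : set (I -> I -> R[i])) (B : set (J -> J -> R[i])) :=
  vN [set tens a b | a in A & b in B].

End Tensor.

Section GroupLp.
Variables (R : realType) (G : groupType).
Implicit Types (p : R) (L : set G).
Local Notation op := (nat * G -> nat * G -> R[i]).

Definition lambda (g : G) : G -> G -> R[i] := fun a b => (a == g * b)%g%:R.

Definition Linfty : set (G -> G -> R[i]) := vN (range lambda).

(* The trace tr (x) tau on B(l^2) (x) Linfty, where tau(x) = x 1 1, is the sum
   of the diagonal entries at the (i, 1). *)
Definition tr_tau_norm p (x : op) : \bar R :=
  Lp_norm [set s : nat * G | s.2 = 1%g] p x.

(* L^p(tr (x) tau) is the completion for the p-norm of the space of the
   elements of B(l^2) (x) Linfty with finite p-norm. Its elements are
   represented by the Cauchy sequences in that space; two sequences u and v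
   represent the same element when the p-norm of u n - v n tends to 0, and all
   the notions below are invariant under this equivalence. *)
Definition Lp_dense p : set op :=
  [set x | vN_tens (@bounded_op R nat) Linfty x /\ (tr_tau_norm p x < +oo)%E].

Definition Lp p : set (nat -> op) :=
  [set u | (forall n, Lp_dense p (u n)) /\
    forall e : R, 0 < e -> exists N : nat, forall m n : nat,
      (N <= m)%N -> (N <= n)%N -> (tr_tau_norm p (u m - u n)%R < e%:E)%E].

Definition Lp_elt_norm p (u : nat -> op) : \bar R :=
  limn (fun n => tr_tau_norm p (u n)).

(* The coefficient x_g = (id (x) tau)(x (1 (x) lambda_g^* )): for a bounded x,
   its (i, j) entry is the entry of x at (i, g), (j, 1), and each of these
   entries is a continuous linear functional on L^p(tr (x) tau). *)
Definition fourier_coef (u : nat -> op) (g : G) : nat -> nat -> R[i] :=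
  fun i j => limn (fun n => u n (i, g) (j, 1%g) : R[i]^o).

Definition Lp_span p L : set op :=
  [set y | exists (F : {fset G}) (c : G -> nat -> nat -> R[i]),
    (forall g, g \in F -> L g /\ Sp p (c g)) /\
    y = \sum_(g <- F) tens (c g) (lambda g)].

(* L^p_L(tr (x) tau): the closed span of the x (x) lambda_g, with x in S^p and
   g in L, in L^p(tr (x) tau). *)
Definition Lp_sub p L : set (nat -> op) :=
  [set u | Lp p u /\ forall e : R, 0 < e -> exists2 y, Lp_span p L y &
    \forall n \near \oo, (tr_tau_norm p (u n - y)%R <= e%:E)%E].

Definition uncond_bound p L (D : R) : Prop :=
  forall (u : nat -> op) (F : {fset G}) (eps : G -> R[i]),
    Lp_sub p L u ->
    (forall g, g \in F -> L g) ->
    (forall g, `|eps g| = 1) ->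
    (tr_tau_norm p
         (\sum_(g <- F) tens (fourier_coef u g) (eps g *: lambda g))%R
       <= D%:E * Lp_elt_norm p u)%E.

Definition completely_unconditional p L : Prop :=
  exists D : R, uncond_bound p L D.

(* The infimum is attained; it is +oo when there is no constant. *)
Definition complete_unconditional_constant p L : \bar R :=
  ereal_inf [set D%:E | D in [set D : R | 0 <= D /\ uncond_bound p L D]].

Definition sumset (A B : set G) : set G := [set (r * c)%g | r in A & c in B].

End GroupLp.

(* Main.v *)
Require Import Defs.
From mathcomp Require Import all_boot all_order all_algebra.
From mathcomp Require Import all_solvable all_field finmap complex.
From mathcomp Require Import all_classical all_reals all_analysis.
From mathcomp Require Import ring lra.
From mathcomp Require summability.

Set Implicit Arguments.
Unset Strict Implicit.
Unset Printing Implicit Defensive.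

Import Order.TTheory GRing.Theory Num.Theory.
Import numFieldNormedType.Exports.

Local Open Scope classical_set_scope.
Local Open Scope ring_scope.

(** Suppose that L contains all the products r_i c_j (i, j < n) and that these
    n^2 products are pairwise different. For an n x n matrix a put
    x_a = sum_ij a_ij E_ij (x) lambda_(r_i c_j). This operator is the product
    of sum_i E_ii (x) lambda_(r_i), a (x) 1 and sum_j E_jj (x) lambda_(c_j),
    and the outer factors are partial unitaries, so that the p-norm of x_a is
    the Schatten p-norm of a. If a and b have unimodular entries, then x_b is
    x_a with its Fourier coefficients multiplied by the unimodular numbers
    b_ij / a_ij, whence ||b||_p <= D ||a||_p for every unconditionality
    constant D of L. The two extreme cases are the matrix J of ones, which is
    n times a projection of rank 1 and has p-norm n, and the Fourier matrix W,
    which is sqrt n times a unitary and has p-norm n^(1/2 + 1/p). Comparing J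
    with W gives D >= n^(1/2 - 1/p) when p >= 2, and comparing W with J gives
    D >= n^(1/p - 1/2) when p <= 2 ([uncond_bound_ge]).

    The elements r_i are any n elements of R, and the c_j are chosen greedily
    in C: r_i c_j = r_i' c_j' means c_j' = r_i'^-1 r_i c_j, so that each c_j
    already chosen excludes at most n^2 elements of C, and n^3 elements allow
    n choices ([sumset_grid]). The bound tends to infinity with n when p <> 2,
    which rules out sumsets of two large sets.

    All norms that occur are those of operators x for which x^* x = s P with a
    projection P and a scalar s >= 0, and then |x|^p = s^(p/2) P
    ([abs_pow_projection]). Since |x|^p is given by polynomial approximation
    of t^(p/2) in the functional calculus, this requires that t^(p/2) be a
    uniform limit of polynomials on bounded intervals ([powR_approx], by means
    of Bernstein polynomials) and that the operator norm of s P be at least s,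
    so that the approximation is effective at the point s
    ([opnorm_ge_projection]). All matrices have a bounded number of nonzero
    entries in each row and column, so that their products are finite sums
    and they define bounded operators by the Schur test ([opnorm_le]). *)

(** * Polynomial approximation of powers *)

Section Approximation.
Variable R : realType.
Implicit Types (x y t e a b M : R) (g h : nat -> R) (n : nat).

(** Evaluated at x, this is the expectation of g (S) for a binomial variable S
    of parameters n and x, computed by conditioning on one of the n trials,
    so that its first moments follow by induction on n. *)
Fixpoint bernstein n g : {poly R} :=
  if n is n'.+1 then
    (1 - 'X) * bernstein n' g + 'X * bernstein n' (g \o succn)
  else (g 0)%:P.

Lemma bernsteinS n g x : (bernstein n.+1 g).[x] =
  (1 - x) * (bernstein n g).[x] + x * (bernstein n (g \o succn)).[x].
Proof. by rewrite /= !hornerE. Qed.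

Lemma bernstein_linear n a b g h x :
  (bernstein n (fun k => a * g k + b * h k)).[x] =
  a * (bernstein n g).[x] + b * (bernstein n h).[x].
Proof.
elim: n g h => [|n IH] g h; first by rewrite /= !hornerC.
by rewrite !bernsteinS IH (IH (g \o succn) (h \o succn)); ring.
Qed.

Lemma bernstein_cst n a x : (bernstein n (fun=> a)).[x] = a.
Proof.
elim: n => [|n IH]; first by rewrite /= hornerC.
by rewrite bernsteinS (_ : (fun=> a) \o succn = fun=> a)// IH; ring.
Qed.

Lemma ler_bernstein n g h x : 0 <= x <= 1 -> (forall k, g k <= h k) ->
  (bernstein n g).[x] <= (bernstein n h).[x].
Proof.
move=> /andP[x0 x1]; elim: n g h => [|n IH] g h gh.
  by rewrite /= !hornerC.
by rewrite !bernsteinS lerD// ler_wpM2l ?IH ?subr_ge0// => k; exact: gh.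
Qed.

Lemma bernstein_id n x : (bernstein n (fun k => k%:R)).[x] = n%:R * x.
Proof.
elim: n => [|n IH]; first by rewrite /= hornerC mul0r.
rewrite bernsteinS IH.
rewrite [X in bernstein n X](_ : _ = fun k => 1 * k%:R + 1 * 1); last first.
  by apply/funext => k /=; rewrite -natr1; ring.
by rewrite bernstein_linear IH bernstein_cst -natr1; ring.
Qed.

Lemma bernstein_sqr n x : (bernstein n (fun k => k%:R ^+ 2)).[x] =
  n%:R * x * (1 - x) + (n%:R * x) ^+ 2.
Proof.
elim: n => [|n IH]; first by rewrite /= hornerC; ring.
rewrite bernsteinS IH.
rewrite [X in bernstein n X](_ : _ =
  fun k => 1 * k%:R ^+ 2 + 1 * (2 * k%:R + 1 * 1)); last first.
  by apply/funext => k /=; rewrite -natr1; ring.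
by rewrite !bernstein_linear IH bernstein_cst bernstein_id -natr1; ring.
Qed.

Lemma bernstein_variance n x : (0 < n)%N ->
  (bernstein n (fun k => (k%:R / n%:R - x) ^+ 2)).[x] = x * (1 - x) / n%:R.
Proof.
move=> n0; have n0' : n%:R != 0 :> R by rewrite pnatr_eq0 -lt0n.
rewrite [X in bernstein n X](_ : _ = fun k => n%:R^-2 * k%:R ^+ 2 +
  1 * ((- 2 * x / n%:R) * k%:R + x ^+ 2 * 1)); last first.
  by apply/funext => k /=; field.
by rewrite !bernstein_linear bernstein_sqr bernstein_id bernstein_cst; field.
Qed.

Lemma powR_subadd a x y : 0 <= a <= 1 -> 0 <= x -> 0 <= y ->
  (x + y) `^ a <= x `^ a + y `^ a.
Proof.
move=> /andP[a0 a1] x0 y0.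
have [s0|s0] := leP (x + y) 0.
  have -> : x = 0 by lra.
  have -> : y = 0 by lra.
  by rewrite addr0 lerDl powR_ge0.
(* the proportion v = u / (x + y) is at most 1, hence v <= v^a *)
have key u : 0 <= u <= x + y -> u / (x + y) * (x + y) `^ a <= u `^ a.
  move=> /andP[u0 us].
  have [->|u0'] := eqVneq u 0; first by rewrite !mul0r powR_ge0.
  have up : 0 < u / (x + y) by rewrite divr_gt0// lt_neqAle eq_sym u0' u0.
  rewrite -{2}(divfK (lt0r_neq0 s0) u) powRM ?(ltW up) ?(ltW s0)//.
  by rewrite ler_wpM2r ?powR_ge0// ger1_powR// up ler_pdivrMr// mul1r.
apply: le_trans (lerD (key x _) (key y _)); last 2 first.
- by rewrite x0 lerDl.
- by rewrite y0 lerDr.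
by rewrite -mulrDl -mulrDl divff ?mul1r// lt0r_neq0.
Qed.

Lemma powR_holder a x y : 0 <= a <= 1 -> 0 <= x -> 0 <= y ->
  `|x `^ a - y `^ a| <= `|x - y| `^ a.
Proof.
move=> a01; wlog xy : x y / x <= y => [H x0 y0|].
  by have [xy|/ltW xy] := leP x y; [|rewrite distrC (distrC x)]; exact: H.
move=> x0 y0; have [a0 a1] := andP a01.
rewrite distrC (distrC x) !ger0_norm ?subr_ge0// ?ge0_ler_powR//.
rewrite lerBlDl; apply: le_trans (powR_subadd a01 x0 _).
  by rewrite addrC subrK.
by rewrite subr_ge0.
Qed.

(** The quadratic term makes this uniform continuity estimate usable in
    expectation: the expectation of (x - y)^2 is the variance computed in
    [bernstein_variance], as in the proof of the weak law of large numbers. *)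
Lemma powR_modulus a e : 0 < a <= 1 -> 0 < e -> exists2 K, 0 <= K &
  forall x y, 0 <= x -> 0 <= y -> `|x `^ a - y `^ a| <= e + K * (x - y) ^+ 2.
Proof.
(* for a distance u <= d, u^a <= e; beyond d, u^a <= 1 <= u^2 / d^2 or
   u^a <= u^2 according to whether u < 1 or not *)
move=> /andP[a0 a1] e0; pose d := e `^ a^-1.
have d0 : 0 < d by rewrite powR_gt0.
exists (1 + d ^- 2) => [|x y x0 y0].
  by rewrite addr_ge0// invr_ge0 sqr_ge0.
apply: (le_trans (powR_holder _ _ _)) => //; first by rewrite (ltW a0).
rewrite -[(x - y) ^+ 2]real_normK ?num_real//.
set u := `|x - y|; have u0 : 0 <= u by exact: normr_ge0.
have u20 : 0 <= u ^+ 2 by rewrite sqr_ge0.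
have d20 : 0 <= d ^- 2 by rewrite invr_ge0 sqr_ge0.
have [ud|du] := leP u d.
  apply: (@le_trans _ _ e); last by rewrite lerDl mulr_ge0// addr_ge0.
  rewrite -[e in leRHS](powRr1 (ltW e0)) -(mulVf (lt0r_neq0 a0)) powRrM.
  by rewrite ge0_ler_powR ?nnegrE ?(ltW a0)// ltW.
apply: (@le_trans _ _ (u ^+ 2 + d ^- 2 * u ^+ 2)).
  have [u1|u1] := leP 1 u.
    apply: (@le_trans _ _ (u ^+ 2)); last by rewrite lerDl mulr_ge0.
    by rewrite -powR_mulrn// ler_powR// (le_trans a1)// ler1n.
  apply: (@le_trans _ _ 1).
    rewrite -(powRr0 u) ger_powR ?(ltW a0)//.
    by rewrite (lt_le_trans d0 (ltW du)) ltW.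
  apply: (@le_trans _ _ (d ^- 2 * u ^+ 2)); last by rewrite lerDr.
  by rewrite mulrC -expr_div_n exprn_ege1// ler_pdivlMr// mul1r ltW.
by rewrite mulrDl mul1r lerDr ltW.
Qed.

Definition poly_approximable M (f : R -> R) := forall e, 0 < e ->
  exists q : {poly R}, forall t, 0 <= t <= M -> `|q.[t] - f t| <= e.

Lemma powR_approx_le1 M a : 0 < M -> 0 < a <= 1 ->
  poly_approximable M (fun t => t `^ a).
Proof.
move=> M0 a01 e e0.
have e20 : 0 < e / 2 by rewrite divr_gt0.
have [K K0 HK] := powR_modulus a01 e20.
have [n nK n_gt0] : exists2 n, K * M ^+ 2 / (e / 2) < n%:R & (0 < n)%N.
  by eexists; first exact: truncnS_gt.
have n0 : 0 < n%:R :> R by rewrite ltr0n.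
exists (bernstein n (fun k => (M * k%:R / n%:R) `^ a) \Po (M^-1 *: 'X)).
move=> t /andP[t0 tM]; rewrite horner_comp hornerZ hornerX.
set x := M^-1 * t.
have x01 : 0 <= x <= 1.
  by rewrite mulr_ge0 ?invr_ge0 ?(ltW M0)//= /x mulrC ler_pdivrMr// mul1r.
have tE : t = M * x by rewrite /x mulrA divff ?mul1r// lt0r_neq0.
set g := fun k => _ `^ a.
pose v k := e / 2 + K * M ^+ 2 * (k%:R / n%:R - x) ^+ 2.
have gv k : `|g k - t `^ a| <= v k.
  apply: le_trans (HK _ _ _ t0) _.
    by rewrite !mulr_ge0// ?invr_ge0 ?ler0n// ltW.
  by rewrite /v lerD2l tE -mulrA -mulrBr exprMn mulrA.
have Ev : (bernstein n v).[x] <= e.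
  rewrite [v](_ : _ = fun k =>
    1 * (e / 2) + (K * M ^+ 2) * (k%:R / n%:R - x) ^+ 2); last first.
    by apply/funext => k; rewrite mul1r.
  rewrite (@bernstein_linear n 1 _ (fun=> e / 2)) bernstein_cst.
  rewrite bernstein_variance//.
  have : K * M ^+ 2 * (x * (1 - x) / n%:R) <= e / 2.
    apply: (@le_trans _ _ (K * M ^+ 2 * n%:R^-1)).
      rewrite ler_wpM2l ?mulr_ge0 ?(ltW M0)//.
      rewrite -[leRHS]mul1r ler_wpM2r ?invr_ge0 ?ltW//.
      have /andP[? ?] := x01; nra.
    by rewrite ler_pdivrMr// [leRHS]mulrC -ler_pdivrMr//; exact: ltW.
  lra.
apply: le_trans Ev.
have lin c : (bernstein n g).[x] - c =
    (bernstein n (fun k => 1 * g k + (- c) * 1)).[x].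
  by rewrite bernstein_linear bernstein_cst; ring.
have linN c : - ((bernstein n g).[x] - c) =
    (bernstein n (fun k => -1 * g k + c * 1)).[x].
  by rewrite bernstein_linear bernstein_cst; ring.
rewrite ler_norml lerNl linN lin.
have gvN k : -1 * g k + t `^ a * 1 <= v k.
  by rewrite mulN1r mulr1 addrC (le_trans (ler_norm _))// distrC.
have gvP k : 1 * g k + - t `^ a * 1 <= v k.
  by rewrite mul1r mulr1 (le_trans (ler_norm _)).
by apply/andP; split; apply: ler_bernstein.
Qed.

(** Exponents above 1 reduce to smaller ones by t^a = t t^(a - 1), as the factor
    t is bounded by M and is itself a polynomial. *)
Lemma powR_approx M a : 0 < M -> 0 < a ->
  poly_approximable M (fun t => t `^ a).
Proof.
move=> M0; have [m] : exists m : nat, a <= m.+1%:R.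
  by exists (Num.truncn a); apply/ltW/truncnS_gt.
elim: m a => [|m IH] a am a0; first by apply: powR_approx_le1; rewrite ?a0.
have [a1|a1] := leP a 1; first by apply: powR_approx_le1; rewrite ?a0.
have /IH : a - 1 <= m.+1%:R by rewrite lerBlDr natr1.
rewrite subr_gt0 => /(_ a1) H e e0.
have [|q Hq] := H (e / M); first by rewrite divr_gt0.
exists ('X * q) => t /andP[t0 tM].
rewrite !hornerE -(mulr_powRB1 t0 a0) -mulrBr normrM.
rewrite -(divfK (lt0r_neq0 M0) e) mulrC ler_pM//.
  by apply: Hq; rewrite t0.
by rewrite ger0_norm.
Qed.

End Approximation.

(** * Matrices with few nonzero entries in each row and column *)

Local Open Scope complex_scope.

Section RealComplex.
Variable R : realType.
Implicit Types (z : R[i]) (c : R).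

Lemma Re_le z c : z <= c%:C -> complex.Re z <= c.
Proof. by rewrite lecE => /andP[]. Qed.

Lemma Re_norm z : (complex.Re `|z|)%:C = `|z|.
Proof. exact/RRe_real/normr_real. Qed.

Lemma norm_real_complex c : `|c%:C| = `|c|%:C :> R[i].
Proof.
have [c0|c0] := leP 0 c; first by rewrite !ger0_norm ?ler0c.
rewrite !ltr0_norm -?rmorphN//.
by rewrite -oppr_gt0 -rmorphN ltcR oppr_gt0.
Qed.

Lemma norm_le_eps_eq0 z c : 0 <= c ->
  (forall e : R, 0 < e -> `|z| <= (e * c)%:C) -> z = 0.
Proof.
move=> c0 H; apply/eqP; rewrite -normr_le0 -Re_norm (_ : 0 = 0%:C)// lecR.
apply/ler_addgt0Pr => e e0; rewrite add0r.
have c1 : 0 < c + 1 by rewrite ltr_wpDl.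
have := H (e / (c + 1)); rewrite divr_gt0// => /(_ isT); rewrite -Re_norm lecR.
move=> /le_trans; apply; rewrite mulrAC ler_pdivrMr// ler_pM2l//; lra.
Qed.

End RealComplex.

Lemma sum_supp_subset (V : nmodType) (I : eqType) (f : I -> V) (s t : seq I) :
  uniq s -> uniq t -> {subset s <= t} -> (forall k, f k != 0 -> k \in s) ->
  \sum_(k <- t) f k = \sum_(k <- s) f k.
Proof.
move=> us ut st fs; rewrite (bigID (mem s)) /= [X in _ + X]big1 ?addr0.
  rewrite -big_filter; apply/perm_big/uniq_perm => //; first exact: filter_uniq.
  move=> k; rewrite mem_filter; apply/andP/idP => [[]|ks]//.
  by split=> //; exact: st.
by move=> k ks; apply/eqP; apply: contraNT ks => /fs.
Qed.

Section SparseMatrices.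
Variables (R : realType) (I : choiceType).
Implicit Types (x y P : I -> I -> R[i]) (f g : I -> R[i]) (s : seq I).
Implicit Types (B : R) (N M : nat).

Lemma summability_sum_finite f s : uniq s -> (forall k, f k != 0 -> k \in s) ->
  summability.sum (fun k => f k : R[i]^o) = \sum_(k <- s) f k.
Proof.
move=> us fs; have FF := @summability.totally_filter I.
apply: cvg_lim; first exact: norm_hausdorff.
apply: cvg_near_cst; exists [fset k in s]%fset => // A /= /fsubsetP sA.
rewrite /summability.partial_sum -(big_seq_fsetE _ A xpredT f).
by apply: sum_supp_subset => // k ks; apply: sA; rewrite inE.
Qed.

Definition few_nonzero N f := exists s,
  [/\ uniq s, (size s <= N)%N & forall k, f k != 0 -> k \in s].

Definition sparse N x :=
  (forall i, few_nonzero N (x i)) /\ (forall j, few_nonzero N (x^~ j)).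

Lemma few_nonzero_sub N f g : (forall k, f k != 0 -> g k != 0) ->
  few_nonzero N g -> few_nonzero N f.
Proof.
by move=> fg [s [us sN gs]]; exists s; split=> // k /fg; exact: gs.
Qed.

Lemma few_nonzeroD N M f g : few_nonzero N f -> few_nonzero M g ->
  few_nonzero (N + M) (fun k => f k + g k).
Proof.
move=> [s [_ sN fs]] [t [_ tM gt]]; exists (undup (s ++ t)); split.
- exact: undup_uniq.
- by rewrite (leq_trans (size_undup _))// size_cat leq_add.
move=> k; rewrite mem_undup mem_cat; apply: contraNT.
rewrite negb_or => /andP[ks kt].
have /eqP -> : f k == 0 by apply: contraNT ks; exact: fs.
by rewrite add0r; apply: contraNT kt; exact: gt.
Qed.

Lemma sparse0 N : sparse N (0 : I -> I -> R[i]).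
Proof. by split=> i; exists [::]; split=> // k /eqP[]. Qed.

Lemma sparse1 : sparse 1 (@op_one R I).
Proof.
split=> i; exists [:: i]; split=> // k; rewrite inE /op_one;
  by have [//|_] := eqVneq i k => /=; rewrite eqxx.
Qed.

Lemma sparseZ N x (a : R[i]) : sparse N x -> sparse N (a *: x).
Proof.
have xa i j : (a *: x) i j != 0 -> x i j != 0.
  by rewrite -[(a *: x) i j]/(a * x i j) mulf_eq0 negb_or => /andP[].
move=> [xr xc]; split=> i.
  by apply: few_nonzero_sub (xr i) => j; exact: xa.
by apply: few_nonzero_sub (xc i) => j; exact: xa.
Qed.

Lemma sparseD N M x y : sparse N x -> sparse M y -> sparse (N + M) (x + y).
Proof.
move=> [xr xc] [yr yc]; split=> i; first exact: few_nonzeroD (xr i) (yr i).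
exact: few_nonzeroD (xc i) (yc i).
Qed.

Lemma sparse_sum (T : eqType) N (l : seq T) (z : T -> I -> I -> R[i]) :
  (forall t, t \in l -> sparse N (z t)) ->
  sparse (size l * N) (\sum_(t <- l) z t).
Proof.
elim: l => [|t l IH] zl; first by rewrite big_nil; exact: sparse0.
rewrite big_cons; apply: sparseD; first by apply: zl; rewrite inE eqxx.
by apply: IH => h hl; apply: zl; rewrite inE hl orbT.
Qed.

Lemma op_mul_rowE x y i j s : uniq s -> (forall k, x i k != 0 -> k \in s) ->
  op_mul x y i j = \sum_(k <- s) x i k * y k j.
Proof.
move=> us xs; apply: summability_sum_finite => // k.
by rewrite mulf_eq0 negb_or => /andP[/xs].
Qed.

Lemma op_mul_colE x y i j s : uniq s -> (forall k, y k j != 0 -> k \in s) ->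
  op_mul x y i j = \sum_(k <- s) x i k * y k j.
Proof.
move=> us xs; apply: summability_sum_finite => // k.
by rewrite mulf_eq0 negb_or => /andP[_ /xs].
Qed.

Lemma op_mulZ N x y (a b : R[i]) : sparse N x ->
  op_mul (a *: x) (b *: y) = (a * b) *: op_mul x y.
Proof.
move=> [xr _]; apply/funext => i; apply/funext => j.
have [s [us _ xs]] := xr i.
rewrite (@op_mul_rowE _ _ _ _ s)//; last first.
  move=> k; rewrite -[(a *: x) i k]/(a * x i k) mulf_eq0 negb_or.
  by move=> /andP[_]; exact: xs.
rewrite -[((a * b) *: op_mul x y) i j]/(a * b * op_mul x y i j).
rewrite (op_mul_rowE _ _ us xs) mulr_sumr; apply: eq_bigr => k _.
by rewrite -[(a *: x) i k]/(a * x i k) -[(b *: y) k j]/(b * y k j) mulrACA.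
Qed.

Lemma op_mulr1 N x : sparse N x -> op_mul x (@op_one R I) = x.
Proof.
move=> [xr _]; apply/funext => i; apply/funext => j.
have [s [us _ xs]] := xr i; rewrite (op_mul_rowE _ _ us xs) /op_one.
have [js|js] := boolP (j \in s).
  rewrite (bigD1_seq j)//= eqxx mulr1 big1 ?addr0// => k /negPf ->.
  by rewrite mulr0.
rewrite big_seq big1 => [|k ks].
  by apply/esym/eqP; apply: contraNT js; exact: xs.
by rewrite (_ : (k == j) = false) ?mulr0//; apply: contraNF js => /eqP <-.
Qed.

Lemma op_mul0 : op_mul (0 : I -> I -> R[i]) 0 = 0.
Proof.
apply/funext => i; apply/funext => j.
rewrite (@op_mul_rowE _ _ _ _ [::])// => [|k]; last by rewrite eqxx.
by rewrite !big_nil.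
Qed.

Lemma op_mulDl N M x x' y : sparse N x -> sparse M x' ->
  op_mul (x + x') y = op_mul x y + op_mul x' y.
Proof.
move=> [xr _] [xr' _]; apply/funext => i; apply/funext => j.
have [l1 [u1 _ h1]] := xr i; have [l2 [u2 _ h2]] := xr' i.
pose l := undup (l1 ++ l2); have ul : uniq l by exact: undup_uniq.
have m1 k : x i k != 0 -> k \in l.
  by move=> /h1; rewrite mem_undup mem_cat => ->.
have m2 k : x' i k != 0 -> k \in l.
  by move=> /h2; rewrite mem_undup mem_cat orbC => ->.
rewrite -[RHS]/(op_mul x y i j + op_mul x' y i j).
rewrite (op_mul_rowE _ _ ul m1) (op_mul_rowE _ _ ul m2).
rewrite (op_mul_rowE _ _ ul (x := x + x')).
  by rewrite -big_split /=; apply: eq_bigr => k _; rewrite -mulrDl.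
move=> k; apply: contraNT => kl; rewrite -[(x + x') i k]/(x i k + x' i k).
have /eqP -> : x i k == 0 by apply: contraNT kl; exact: m1.
by rewrite add0r; apply: contraNT kl; exact: m2.
Qed.

Lemma op_mul_trmx x y :
  op_mul x y = fun i j => op_mul (fun k l => y l k) (fun k l => x l k) j i.
Proof.
apply/funext => i; apply/funext => j; rewrite /op_mul.
by have -> : (fun k => x i k * y k j) = (fun k => y k j * x i k)
  by apply/funext => k; rewrite mulrC.
Qed.

Lemma sparse_trmx N x : sparse N x -> sparse N (fun i j => x j i).
Proof. by case. Qed.

Lemma op_mulDr N M x x' y : sparse N x -> sparse M x' ->
  op_mul y (x + x') = op_mul y x + op_mul y x'.
Proof.
move=> /sparse_trmx xs /sparse_trmx xs'; rewrite !(op_mul_trmx y).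
apply/funext => i; apply/funext => j.
have := op_mulDl (fun k l => y l k) xs xs'.
by move=> /(congr1 (fun z : I -> I -> R[i] => z j i)).
Qed.

Lemma commute_sum (T : eqType) N (l : seq T) (z : T -> I -> I -> R[i]) y :
  (forall t, t \in l -> sparse N (z t)) ->
  (forall t, t \in l -> op_mul y (z t) = op_mul (z t) y) ->
  op_mul y (\sum_(t <- l) z t) = op_mul (\sum_(t <- l) z t) y.
Proof.
elim: l => [|t l IH] zl zy.
  rewrite big_nil; apply/funext => i; apply/funext => j.
  rewrite (@op_mul_colE _ _ _ _ [::])// => [|k]; last by rewrite eqxx.
  rewrite (@op_mul_rowE _ _ _ _ [::])// => [|k]; last by rewrite eqxx.
  by rewrite !big_nil.
have lz h : h \in l -> sparse N (z h).
  by move=> hl; apply: zl; rewrite inE hl orbT.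
have tz : sparse N (z t) by apply: zl; rewrite inE eqxx.
have sz := sparse_sum lz.
rewrite big_cons (op_mulDr _ tz sz) (op_mulDl _ tz sz).
rewrite zy ?inE ?eqxx// IH// => h hl.
by apply: zy; rewrite inE hl orbT.
Qed.

Lemma sparse_row_norm N x B s i : 0 <= B -> sparse N x ->
  (forall i j, `|x i j| <= B%:C) -> uniq s ->
  \sum_(j <- s) `|x i j| <= (N%:R * B)%:C.
Proof.
move=> B0 [xr _] xB us; have [t [ut tN xt]] := xr i.
rewrite (bigID (mem t)) /= [X in _ + X]big1 ?addr0; last first.
  by move=> k kt; apply/normr0P; apply: contraNT kt => /xt.
apply: le_trans (ler_sum _ (fun k _ => xB i k)) _.
rewrite -big_filter big_const_seq count_predT iter_addr_0.
rewrite [leRHS]rmorphM rmorph_nat mulr_natl.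
rewrite ler_wpMn2l ?ler0c// (leq_trans _ tN)//.
apply: uniq_leq_size; first exact: filter_uniq.
by move=> k; rewrite mem_filter => /andP[].
Qed.

(** The Schur test: |v_i x_ij u_j| <= |x_ij| (|v_i|^2 + |u_j|^2) / 2, and the
    absolute values of the entries of a row or column of x add up to at most
    N B. *)
Lemma opnorm_le N x B : 0 <= B -> sparse N x ->
  (forall i j, `|x i j| <= B%:C) -> (opnorm x <= (N%:R * B)%:E)%E.
Proof.
move=> B0 xN xB; apply: ub_ereal_sup => z [F [u [v [u1 v1 ->]]]].
rewrite lee_fin; apply: Re_le; set K := (N%:R * B)%:C.
have K0 : 0 <= K by rewrite ler0c mulr_ge0.
have uF := fset_uniq F.
apply: (le_trans (ler_norm_sum _ _ _)).
apply: (@le_trans _ _ (\sum_(i <- F) \sum_(j <- F)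
   (`|x i j| * `|v i| ^+ 2 / 2 + `|x i j| * `|u j| ^+ 2 / 2))).
  apply: ler_sum => i _; apply: (le_trans (ler_norm_sum _ _ _)).
  apply: ler_sum => j _; rewrite !normrM normcJ.
  rewrite mulrAC mulrC -mulrDl -mulrDr -mulrA.
  by rewrite ler_wpM2l// real_leif_mean_square ?normr_real.
under eq_bigr do rewrite big_split /=.
rewrite big_split /= [X in _ + X]exchange_big /= [leRHS](splitr K) lerD//.
  apply: (@le_trans _ _ (\sum_(i <- F) K / 2 * `|v i| ^+ 2)); last first.
    by rewrite -mulr_sumr -[leRHS]mulr1 ler_wpM2l// divr_ge0.
  apply: ler_sum => i _; rewrite -!mulr_suml mulrAC ler_wpM2r ?exprn_ge0//.
  by rewrite ler_wpM2r ?invr_ge0// (sparse_row_norm _ _ xN).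
apply: (@le_trans _ _ (\sum_(i <- F) K / 2 * `|u i| ^+ 2)); last first.
  by rewrite -mulr_sumr -[leRHS]mulr1 ler_wpM2l// divr_ge0.
apply: ler_sum => i _; rewrite -!mulr_suml mulrAC ler_wpM2r ?exprn_ge0//.
rewrite ler_wpM2r ?invr_ge0//.
exact: (sparse_row_norm i B0 (sparse_trmx xN) (fun i j => xB j i)).
Qed.

Lemma sparse_bounded N x B : 0 <= B -> sparse N x ->
  (forall i j, `|x i j| <= B%:C) -> bounded_op x.
Proof.
move=> B0 xN xB.
by rewrite /bounded_op /= (le_lt_trans (opnorm_le B0 xN xB))// ltry.
Qed.

Lemma opnorm_ge x (F : {fset I}) (u v : I -> R[i]) :
  \sum_(i <- F) `|u i| ^+ 2 <= 1 -> \sum_(i <- F) `|v i| ^+ 2 <= 1 ->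
  ((complex.Re
      `|\sum_(i <- F) \sum_(j <- F) (v i)^* * x i j * u j|)%:E <= opnorm x)%E.
Proof. by move=> u1 v1; apply: ereal_sup_ubound; exists F, u, v. Qed.

Lemma opnorm_ge0 x : (0 <= opnorm x)%E.
Proof.
have := @opnorm_ge x fset0 (fun=> 0) (fun=> 0).
by rewrite !big_seq_fset0 normr0; apply; rewrite ler01.
Qed.

Lemma sum_delta s f i : uniq s -> i \in s ->
  \sum_(k <- s) f k * (k == i)%:R = f i.
Proof.
move=> us si; rewrite (bigD1_seq i)//= eqxx mulr1 big1 ?addr0// => k /negPf ->.
by rewrite mulr0.
Qed.

Lemma opnorm_ge_entry x i j : ((complex.Re `|x i j|)%:E <= opnorm x)%E.
Proof.
pose F := [fset i; j]%fset.
have iF : i \in (F : seq I) by rewrite !inE eqxx.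
have jF : j \in (F : seq I) by rewrite !inE eqxx orbT.
have uF := fset_uniq F.
have u1 k : k \in (F : seq I) -> \sum_(i <- F) `|(i == k)%:R : R[i]| ^+ 2 <= 1.
  move=> kF; rewrite (eq_bigr (fun i => 1 * (i == k)%:R)).
    by rewrite sum_delta.
  by move=> l _; case: (_ == _);
    rewrite ?normr1 ?normr0 ?expr1n ?expr0n /= ?mulr1 ?mulr0.
have := @opnorm_ge x F (fun k => (k == j)%:R) (fun k => (k == i)%:R)
  (u1 _ jF) (u1 _ iF).
rewrite (_ : \sum_(i0 <- F) _ = x i j)//.
rewrite (eq_bigr (fun k => x k j * (k == i)%:R)); first by rewrite sum_delta.
move=> k _; rewrite (eq_bigr (fun l => (k == i)%:R * x k l * (l == j)%:R)).
  by rewrite sum_delta// mulrC.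
by move=> l _; congr (_ * _ * _); exact: conjc_nat.
Qed.

End SparseMatrices.

(** * Functional calculus of multiples of projections *)

Section FunctionalCalculus.
Variables (R : realType) (I : choiceType).
Implicit Types (x b P : I -> I -> R[i]) (f : R -> R) (s p M : R) (N : nat).

Definition sparse_projection N P :=
  [/\ sparse N P, op_adj P = P & op_mul P P = P].

Lemma projection_col_norm N P t (F : {fset I}) : sparse_projection N P ->
  (forall k, P k t != 0 -> k \in F) -> \sum_(k <- F) `|P k t| ^+ 2 = P t t.
Proof.
move=> [_ Pa Pi] PF; rewrite -[in RHS]Pi (op_mul_colE _ _ (fset_uniq F) PF).
by apply: eq_bigr => k _; rewrite -[in P t k]Pa sqr_normc mulrC.
Qed.

Lemma projection_entry_le_diag N P i j : sparse_projection N P ->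
  `|P i j| ^+ 2 <= P j j.
Proof.
move=> PP; have [[_ Pc] _ _] := PP.
have [sq [_ _ sqP]] := Pc j.
have FP l : P l j != 0 -> l \in [fset l in sq]%fset.
  by rewrite inE /=; exact: sqP.
rewrite -(projection_col_norm PP FP).
have [->|/FP iF] := eqVneq (P i j) 0.
  by rewrite normr0 expr0n sumr_ge0// => l _; rewrite exprn_ge0.
by rewrite (bigD1_seq i)//= lerDl sumr_ge0// => l _; rewrite exprn_ge0.
Qed.

Lemma projection_diag_ge0 N P j : sparse_projection N P -> 0 <= P j j.
Proof.
move=> PP.
by rewrite (le_trans _ (projection_entry_le_diag j j PP))// exprn_ge0.
Qed.

Lemma projection_entry_le1 N P i j : sparse_projection N P -> `|P i j| <= 1.
Proof.
move=> PP; have d0 := projection_diag_ge0 j PP.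
have d1 : P j j <= 1.
  have := projection_entry_le_diag j j PP; rewrite ger0_norm//.
  have [->//|dn0] := eqVneq (P j j) 0.
  by rewrite expr2 ger_pMr// lt0r dn0.
by rewrite -(@expr_le1 _ 2)// (le_trans (projection_entry_le_diag i j PP)).
Qed.

(** The t-th column of P is a vector of finite support fixed by P; it is
    nonzero as its squared norm is P t t. *)
Lemma opnorm_ge_projection N P s t : sparse_projection N P -> 0 <= s ->
  P t t != 0 -> (s%:E <= opnorm (s%:C *: P))%E.
Proof.
move=> PP s0 Pt; have [[_ Pc] Pa Pi] := PP.
have [sq [_ _ sqP]] := Pc t.
pose F := [fset k in sq]%fset.
have FP k : P k t != 0 -> k \in F by rewrite inE /=; exact: sqP.
have PtE := projection_col_norm PP FP.
have Pt0 : 0 < P t t by rewrite lt0r Pt (projection_diag_ge0 t PP).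
pose r := complex.Re (P t t).
have rE : r%:C = P t t by apply/RRe_real/gtr0_real.
have r0 : 0 < r by have := Pt0; rewrite -rE ltcR.
pose al := (Num.sqrt r)^-1.
have al2 : (al%:C) ^+ 2 * P t t = 1.
  rewrite -rE -rmorphXn -rmorphM /al exprVn sqr_sqrtr ?ltW// mulVf ?rmorph1//.
  exact: lt0r_neq0.
have al0 : 0 <= al%:C by rewrite ler0c invr_ge0 sqrtr_ge0.
have u1 : \sum_(k <- F) `|al%:C * P k t| ^+ 2 <= 1.
  under eq_bigr do rewrite normrM (ger0_norm al0) exprMn.
  by rewrite -mulr_sumr PtE al2.
have := opnorm_ge (s%:C *: P) u1 u1.
rewrite (_ : \sum_(i <- F) _ = s%:C); first by rewrite ger0_norm ?ler0c.
rewrite (eq_bigr (fun i => s%:C * (al%:C ^+ 2 * `|P i t| ^+ 2))).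
  by rewrite -!mulr_sumr PtE al2 mulr1.
move=> i _.
rewrite (eq_bigr (fun j =>
  (s%:C * al%:C ^+ 2 * conjc (P i t)) * (P i j * P j t))).
  rewrite -mulr_sumr -(op_mul_colE P i (fset_uniq F) FP) Pi -!mulrA.
  by rewrite [conjc _ * _]mulrC sqr_normc.
move=> j _; rewrite -[(s%:C *: P) i j]/(s%:C * P i j).
rewrite (_ : Num.conj (al%:C * P i t) = al%:C * conjc (P i t)); last first.
  by rewrite -[LHS]/(conjc _) rmorphM; congr (_ * _); exact: conjc_real.
ring.
Qed.

Lemma op_exp_projection N P s k : sparse_projection N P ->
  op_exp (s%:C *: P) k =
  (0 ^+ k)%:C *: @op_one R I + (s ^+ k - 0 ^+ k)%:C *: P.
Proof.
move=> [Ps _ Pi]; case: k => [|k].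
  by rewrite !expr0 subrr scale1r scale0r addr0.
rewrite expr0n /= scale0r add0r subr0.
elim: k => [|k IH].
  rewrite /op_exp /= -[@op_one R I in LHS]scale1r.
  by rewrite (op_mulZ _ _ _ Ps) (op_mulr1 Ps) mulr1 expr1.
rewrite -[op_exp _ k.+1]/(op_mul _ (op_exp _ k)) IH (op_mulZ _ _ _ Ps) Pi.
by rewrite [in RHS]exprS rmorphM.
Qed.

Lemma op_horner_projection N P s (q : {poly R}) : sparse_projection N P ->
  op_horner q (s%:C *: P) =
  (q.[0])%:C *: @op_one R I + (q.[s] - q.[0])%:C *: P.
Proof.
move=> PP; rewrite /op_horner.
under eq_bigr
  do rewrite (op_exp_projection _ _ PP) scalerDr !scalerA -!rmorphM mulrBr.
rewrite big_split /= -!scaler_suml -!rmorph_sum sumrB.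
by rewrite -!horner_coef.
Qed.

Lemma op_one_entry_le1 (i j : I) : `|op_one R i j : R[i]| <= 1.
Proof. by rewrite /op_one; case: (i == j); rewrite ?normr1 ?normr0. Qed.

(** The condition on the diagonal says that P is nonzero unless s = 0; it puts
    s into the interval on which the polynomials converge, and this interval
    contains 0 anyway. *)
Lemma is_fun_calc_projection_uniq f N P s b : sparse_projection N P ->
  0 <= s -> (s != 0 -> exists t, P t t != 0) -> is_fun_calc f (s%:C *: P) b ->
  b = (f 0)%:C *: @op_one R I + (f s - f 0)%:C *: P.
Proof.
move=> PP s0 sP [M [q [aM qM]]].
have M0 : 0 <= M by rewrite -lee_fin (le_trans (opnorm_ge0 _) aM).
have sM : s <= M.
  have [->//|/sP[t Pt]] := eqVneq s 0.
  by rewrite -lee_fin (le_trans (opnorm_ge_projection PP s0 Pt)).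
apply/funext => i; apply/funext => j; apply/esym/eqP.
rewrite -subr_eq0; apply/eqP.
(* 4 e = e for the coefficient of 1, 2 e for that of P, and e for the distance
   of b to the value of q_n *)
apply: (@norm_le_eps_eq0 _ _ 4) => // e e0.
have [n _ /(_ n (leqnn _)) /= [qf qb]] := qM e e0.
have qf0 : `|(q n).[0] - f 0| <= e by apply: qf; rewrite lexx.
have qfs : `|(q n).[s] - f s| <= e by apply: qf; rewrite s0.
have := le_trans (opnorm_ge_entry _ i j) qb.
rewrite lee_fin -lecR Re_norm (op_horner_projection _ _ PP) => {}qb.
have P1 := projection_entry_le1 i j PP.
have o1 := op_one_entry_le1 i j.
rewrite -lecR -norm_real_complex in qf0.
rewrite -lecR -norm_real_complex in qfs.
set T := (X in `|X|).
rewrite (_ : T = ((f 0)%:C - (q n).[0]%:C) * op_one R i j +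
   (((f s)%:C - (q n).[s]%:C) + ((q n).[0]%:C - (f 0)%:C)) * P i j +
   (((q n).[0]%:C *: @op_one R I + ((q n).[s] - (q n).[0])%:C *: P - b) i j)).
  have -> : (e * 4)%:C = (e%:C * 1 + (e%:C + e%:C) * 1 + e%:C) :> R[i].
    by rewrite !mulr1 -!rmorphD; congr (_%:C); ring.
  apply: (le_trans (ler_normD _ _)); apply: lerD => //.
  apply: (le_trans (ler_normD _ _)); rewrite !normrM; apply: lerD.
    by apply: ler_pM => //; rewrite distrC -rmorphB.
  apply: ler_pM => //; apply: (le_trans (ler_normD _ _)); apply: lerD.
    by rewrite distrC -rmorphB.
  by rewrite -rmorphB.
by rewrite /T !fctE /= /GRing.scale /= !rmorphB; ring.
Qed.

Lemma is_fun_calc_projection f N P s : sparse_projection N P -> 0 <= s ->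
  (forall M, 0 < M -> poly_approximable M f) ->
  is_fun_calc f (s%:C *: P) ((f 0)%:C *: @op_one R I + (f s - f 0)%:C *: P).
Proof.
move=> PP s0 fa; have [Ps _ _] := PP.
(* N s bounds the operator norm; s and 1 ensure s <= M and 0 < M *)
pose M := N%:R * s + s + 1.
have M0 : 0 < M by rewrite ltr_wpDl// addr_ge0// mulr_ge0.
have Ns0 : 0 <= N%:R * s by rewrite mulr_ge0.
have sM : s <= M by rewrite /M; lra.
have /choice[q qP] : forall n : nat, exists q : {poly R},
    forall t, 0 <= t <= M -> `|q.[t] - f t| <= n.+1%:R^-1.
  by move=> n; apply: fa; rewrite ?invr_gt0.
exists M, q; split.
  apply: (@le_trans _ _ (N%:R * s)%:E).
    apply: opnorm_le => //; first exact: (sparseZ _ Ps).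
    move=> i j; rewrite -[(_ *: _) i j]/(s%:C * P i j).
    rewrite normrM norm_real_complex (ger0_norm s0).
    by rewrite ler_piMr ?ler0c// (projection_entry_le1 i j PP).
  by rewrite lee_fin /M -addrA lerDl addr_ge0.
move=> e e0.
(* the difference of q_n and f in the calculus has at most N + 1 nonzero
   entries per row, each one at most three times the error of q_n *)
pose K : R := N.+1%:R * 3.
have K0 : 0 < K by rewrite mulr_gt0.
have eK : 0 < e / K by rewrite divr_gt0.
have := near_infty_natSinv_lt (PosNum eK); apply: filterS => n /= ne.
have qf t : 0 <= t <= M -> `|(q n).[t] - f t| <= e / K.
  by move=> tM; rewrite (le_trans (qP n t tM))// ltW.
split=> [t tM|].
  rewrite (le_trans (qf t tM))// ler_pdivrMr// ler_peMr// ?ltW//.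
  by rewrite /K -natrM ltr1n mulSn.
have qf0 := qf 0; have qfs := qf s.
rewrite lexx ltW// in qf0; rewrite s0 sM in qfs.
move: (qf0 isT) (qfs isT) => {}qf0 {}qfs.
rewrite (op_horner_projection _ _ PP).
set c0 := (q n).[0] - f 0 in qf0; set cs := (q n).[s] - f s in qfs.
rewrite (_ : _ - _ = c0%:C *: @op_one R I + (cs - c0)%:C *: P); last first.
  rewrite opprD addrACA -!scalerBl -!rmorphB.
  by congr (_ + _%:C *: _); rewrite /cs /c0; ring.
have -> : e = N.+1%:R * (3 * (e / K)).
  by rewrite mulrA -/K mulrC divfK// lt0r_neq0.
apply: opnorm_le; first by rewrite mulr_ge0// ltW.
  exact: (sparseD (sparseZ _ (sparse1 R I)) (sparseZ _ Ps)).
move=> i j.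
rewrite -[X in `|X|]/(c0%:C * op_one R i j + (cs - c0)%:C * P i j).
have o1 := op_one_entry_le1 i j.
have P1 := projection_entry_le1 i j PP.
have -> : (3 * (e / K))%:C = (e / K)%:C * 1 + (e / K + e / K)%:C * 1 :> R[i].
  by rewrite !mulr1 -!rmorphD; congr (_%:C); ring.
apply: (le_trans (ler_normD _ _)).
rewrite !normrM !norm_real_complex; apply: lerD.
  by apply: ler_pM => //; rewrite ?ler0c ?lecR.
apply: ler_pM => //; rewrite ?ler0c ?lecR//.
by rewrite (le_trans (ler_normB _ _))// lerD.
Qed.

Lemma abs_pow_projection p x N P s : sparse_projection N P -> 0 <= s ->
  (s != 0 -> exists t, P t t != 0) -> 0 < p ->
  op_mul (op_adj x) x = s%:C *: P -> abs_pow p x = (s `^ (p / 2))%:C *: P.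
Proof.
move=> PP s0 sP p0 xx; have p20 : 0 < p / 2 by rewrite divr_gt0.
have f0 : 0 `^ (p / 2) = 0 :> R by rewrite powR0// lt0r_neq0.
have fE : (s `^ (p / 2))%:C *: P = (0 `^ (p / 2))%:C *: @op_one R I +
    (s `^ (p / 2) - 0 `^ (p / 2))%:C *: P.
  by rewrite f0 subr0 scale0r add0r.
rewrite /abs_pow xx fE; apply: xget_unique.
  by apply: is_fun_calc_projection PP s0 _ => M M0; exact: powR_approx.
by move=> b; exact: (is_fun_calc_projection_uniq PP s0 sP).
Qed.

Lemma Lp_norm_projection (D : set I) p x N P s : sparse_projection N P ->
  0 <= s -> (s != 0 -> exists t, P t t != 0) -> 0 < p ->
  op_mul (op_adj x) x = s%:C *: P ->
  Lp_norm D p x =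
  ((\esum_(i in D) (s `^ (p / 2) * complex.Re (P i i))%:E) `^ p^-1)%E.
Proof.
move=> PP s0 sP p0 xx.
rewrite /Lp_norm /diag_trace (abs_pow_projection PP s0 sP p0 xx).
congr (_ `^ _)%E; apply: eq_esum => i _; congr (_%:E).
by rewrite -[(_ *: _) i i]/(_ * P i i); case: (P i i) => a b /=; ring.
Qed.

Lemma Lp_norm0 (D : set I) p : 0 < p -> Lp_norm D p (0 : I -> I -> R[i]) = 0%E.
Proof.
move=> p0; have a0 : op_adj (0 : I -> I -> R[i]) = 0.
  by apply/funext => i; apply/funext => j; exact: conjc0.
have PP : sparse_projection 0 (0 : I -> I -> R[i]).
  by split=> //; [exact: sparse0|exact: op_mul0].
have t0 : 0 != 0 :> R -> exists t : I, (0 : I -> I -> R[i]) t t != 0.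
  by rewrite eqxx.
have s0 : op_mul (op_adj (0 : I -> I -> R[i])) 0 = 0%:C *: 0.
  by rewrite a0 op_mul0 scaler0.
rewrite (Lp_norm_projection D PP (lexx 0) t0 p0 s0).
rewrite esum1 ?poweR0r// ?invr_neq0 ?lt0r_neq0// => i _.
by rewrite powR0 ?mul0r// mulf_neq0 ?invr_neq0// lt0r_neq0.
Qed.

End FunctionalCalculus.

(** * Fourier matrices *)

Section FourierMatrix.
Variable R : realType.

Lemma complex_prim_root_exists n : (0 < n)%N ->
  exists z : R[i], n.-primitive_root z.
Proof.
pose p : {poly R[i]} := 'X^n - 1; have [r Dp] := closed_field_poly_normal p.
move=> n_gt0; rewrite (monicP _) ?monicXnsubC // scale1r in Dp.
have rn1: all n.-unity_root r by apply/allP=> z; rewrite -root_prod_XsubC -Dp.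
have sz_r: (n < (size r).+1)%N.
  by rewrite -(size_prod_XsubC r id) -Dp size_XnsubC.
have [|z] := hasP (has_prim_root n_gt0 rn1 _ sz_r); last by exists z.
by rewrite -separable_prod_XsubC -Dp separable_Xn_sub_1 // pnatr_eq0 -lt0n.
Qed.

Lemma fourier_matrix_exists n : (0 < n)%N -> exists w : nat -> nat -> R[i],
  (forall i j, `|w i j| = 1) /\
  (forall i j, (i < n)%N -> (j < n)%N ->
     \sum_(0 <= k < n) (w k i)^* * w k j = n%:R * (i == j)%:R).
Proof.
move=> n0; have [z zP] := complex_prim_root_exists n0.
have zn : z ^+ n = 1 by exact: prim_expr_order.
have z1 : `|z| = 1.
  by apply/eqP; rewrite -(@pexpr_eq1 _ _ n)// -normrX zn normr1.
exists (fun i j => z ^+ (i * j)); split=> [i j|i j i_n j_n].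
  by rewrite normrX z1 expr1n.
(* the sum is geometric, of ratio z^(j - i), an n-th root of unity *)
pose x := z ^+ j * conjc (z ^+ i).
rewrite (eq_bigr (fun k => x ^+ k)); last first.
  move=> k _; rewrite /x exprMn -!exprM mulrC mulnC; congr (_ * _).
  by rewrite -[LHS]/(conjc _) -rmorphXn -exprM mulnC.
have [ij|ij] := eqVneq i j.
  rewrite /x ij -sqr_normc normrX z1 !expr1n.
  by under eq_bigr do rewrite expr1n; rewrite sumr_const_nat subn0 mulr1.
have xn : x ^+ n = 1.
  rewrite /x exprMn -rmorphXn -!exprM !(mulnC _ n) !exprM zn.
  by rewrite !expr1n mul1r rmorph1.
have x1 : x != 1.
  apply: contra ij => /eqP x1.
  have : z ^+ i = z ^+ j.
    rewrite -[LHS]mul1r -x1 /x -mulrA [conjc _ * _]mulrC -sqr_normc.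
    by rewrite normrX z1 !expr1n mulr1.
  by move=> /eqP; rewrite (eq_prim_root_expr zP) !modn_small.
rewrite mulr0; have := subrX1 x n; rewrite xn subrr => /esym/eqP.
rewrite mulf_eq0 subr_eq0 (negPf x1) /= => /eqP x0.
by rewrite big_mkord.
Qed.

End FourierMatrix.

(** * Matrices over the group *)

Lemma esum_seq_supp (R : realType) (I : choiceType) (D : set I) (l : seq I)
    (a : I -> R) :
  uniq l -> (forall k, k \in l -> D k) ->
  (forall k, D k -> a k != 0 -> k \in l) ->
  (forall k, 0 <= a k) -> \esum_(i in D) (a i)%:E = (\sum_(k <- l) a k)%:E.
Proof.
move=> ul lD aD a0.
rewrite (esumID [set` l]); last by move=> i _; rewrite lee_fin.
rewrite [X in (_ + X)%E]esum1 ?adde0; last first.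
  move=> i [Di /= li]; congr _%:E; apply/eqP; apply: contrapT => /negP ai.
  exact: li (aD _ Di ai).
rewrite (_ : D `&` _ = [set` l]); last first.
  by apply/seteqP; split=> [k []//|k /= kl]; split=> //; exact: lD.
rewrite esum_fset//; last by move=> i _; rewrite lee_fin.
by rewrite -fsbig_seq// sumEFin.
Qed.

Section GroupMatrices.
Variables (R : realType) (G : groupType).
Implicit Types (r c d : nat -> G) (a b m : nat -> nat -> R[i]) (n : nat).

(** The operator sum_ij a_ij E_ij (x) lambda_(r_i^-1 c_j) (i, j < n). In this
    form r and c label the rows and columns, and a product of two such
    operators reduces to a matrix product when the inner labels agree. *)
Definition group_mx r c n a : nat * G -> nat * G -> R[i] := fun s t =>
  a s.1 t.1 *+ [&& (s.1 < n)%N, (t.1 < n)%N & (r s.1 * s.2 == c t.1 * t.2)%g].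

Definition group_mx_row r c n (s : nat * G) : seq (nat * G) :=
  [seq (k, ((c k)^-1 * (r s.1 * s.2))%g) | k <- index_iota 0 n].

Lemma group_mx_rowP r c n a s t :
  group_mx r c n a s t != 0 -> t \in group_mx_row r c n s.
Proof.
rewrite /group_mx; case: and3P => [[sn tn /eqP rc] _|_].
  apply/mapP; exists t.1; first by rewrite mem_index_iota.
  by rewrite rc mulKg -surjective_pairing.
by rewrite mulr0n eqxx.
Qed.

Lemma group_mx_row_uniq r c n s : uniq (group_mx_row r c n s).
Proof. by rewrite map_inj_in_uniq ?iota_uniq// => i j _ _ []. Qed.

Lemma group_mx_sparse r c n a : sparse n (group_mx r c n a).
Proof.
split=> i.
  exists (group_mx_row r c n i).
  rewrite group_mx_row_uniq size_map size_iota subn0.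
  by split=> // k; exact: group_mx_rowP.
exists (group_mx_row c r n i).
rewrite group_mx_row_uniq size_map size_iota subn0.
split=> // k H; apply: (@group_mx_rowP _ _ _ (fun i j => a j i)).
by move: H; rewrite /group_mx andbCA (eq_sym (r _ * _)%g).
Qed.

Lemma group_mx_mul r c d n a b :
  op_mul (group_mx r d n a) (group_mx d c n b) =
  group_mx r c n (fun i j => \sum_(0 <= k < n) a i k * b k j).
Proof.
apply/funext => s; apply/funext => t.
rewrite (op_mul_rowE _ _ (group_mx_row_uniq r d n s)); last first.
  exact: group_mx_rowP.
rewrite big_map /group_mx /= -sumrMnl; apply: eq_big_nat => k /andP[_ kn].
rewrite kn /= mulVKg eqxx !andbT.
by case: (s.1 < n)%N; case: (t.1 < n)%N; case: eqP;
  rewrite ?mulr0n ?mulr1n ?mul0r ?mulr0.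
Qed.

Lemma group_mx_adj r c n a :
  op_adj (group_mx r c n a) = group_mx c r n (op_adj a).
Proof.
apply/funext => s; apply/funext => t; rewrite /op_adj /group_mx rmorphMn /=.
by rewrite andbCA (eq_sym (r _ * _)%g).
Qed.

Lemma eq_group_mx r c n a b :
  (forall i j, (i < n)%N -> (j < n)%N -> a i j = b i j) ->
  group_mx r c n a = group_mx r c n b.
Proof.
move=> ab; apply/funext => s; apply/funext => t; rewrite /group_mx.
by case: and3P => [[sn tn _]|_]; [rewrite ab|rewrite !mulr0n].
Qed.

Lemma group_mxZ r c n a (z : R[i]) :
  group_mx r c n (z *: a) = z *: group_mx r c n a.
Proof.
apply/funext => s; apply/funext => t.
by rewrite -[RHS]/(z * _) -[LHS]/((z * _) *+ _) mulrnAr.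
Qed.

(** The hypotheses say that a^* a = s m, where m is a nonzero projection; then
    x^* x = s P for x = group_mx r c n a and P = group_mx c c n m, and the
    trace of P is that of m. *)
Lemma group_mx_norm r c n a m (s p : R) (i0 : nat) :
  (forall i j, (i < n)%N -> (j < n)%N ->
     \sum_(0 <= k < n) (a k i)^* * a k j = s%:C * m i j) ->
  (forall i j, (i < n)%N -> (j < n)%N ->
     \sum_(0 <= k < n) m i k * m k j = m i j) ->
  (forall i j, (i < n)%N -> (j < n)%N -> (m j i)^* = m i j) ->
  0 <= s -> (i0 < n)%N -> m i0 i0 != 0 -> 0 < p ->
  tr_tau_norm p (group_mx r c n a) =
  ((s `^ (p / 2) * complex.Re (\sum_(0 <= k < n) m k k)) `^ p^-1)%:E.
Proof.
move=> aa mm ma s0 i0n m0 p0.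
have PP : sparse_projection n (group_mx c c n m).
  split; first exact: group_mx_sparse.
    by rewrite group_mx_adj; exact: eq_group_mx.
  by rewrite group_mx_mul; exact: eq_group_mx.
rewrite /tr_tau_norm (Lp_norm_projection _ (s := s) PP)//; first last.
- by rewrite group_mx_adj group_mx_mul -group_mxZ; exact: eq_group_mx.
- by move=> _; exists (i0, 1%g); rewrite /group_mx /= i0n eqxx.
have mE k : (k < n)%N -> group_mx c c n m (k, 1%g) (k, 1%g) = m k k.
  by move=> kn; rewrite /group_mx /= kn eqxx.
rewrite (esum_seq_supp (l := [seq (k, 1%g) | k <- index_iota 0 n])).
- rewrite poweR_EFin big_map -mulr_sumr raddf_sum; congr ((_ * _) `^ _)%:E.
  by apply: eq_big_nat => k /andP[_ kn]; rewrite mE.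
- by rewrite map_inj_uniq ?iota_uniq// => i j [].
- by move=> k /mapP[i _ ->].
- move=> [k g] /= ->; rewrite mulf_eq0 negb_or => /andP[_].
  rewrite /group_mx /=; case: (ltnP k n) => kn.
    by move=> _; apply/mapP; exists k => //; rewrite mem_index_iota.
  by rewrite mulr0n /= eqxx.
- move=> k; rewrite mulr_ge0 ?powR_ge0//.
  by have := projection_diag_ge0 k PP; rewrite lecE => /andP[].
Qed.

End GroupMatrices.

Section MatrixUnits.
Variable R : realType.

Definition matrix_unit (i j : nat) : nat -> nat -> R[i] :=
  fun k l => ((k == i) && (l == j))%:R.

Lemma matrix_unit_sparse i j : sparse 1 (matrix_unit i j).
Proof.
split=> k; [exists [:: j]|exists [:: i]]; split=> // l;
  rewrite inE /matrix_unit;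
  by case: (k == _) => /=; case: (l == _) => //=; rewrite eqxx.
Qed.

Lemma matrix_unit_mul i j k :
  op_mul (matrix_unit i j) (matrix_unit j k) = matrix_unit i k.
Proof.
apply/funext => s; apply/funext => t.
rewrite (@op_mul_rowE _ _ _ _ _ _ [:: j])//.
  by rewrite big_seq1 /matrix_unit eqxx andbT /= -natrM mulnb.
by move=> l; rewrite inE /matrix_unit; case: (l == j); rewrite // andbF eqxx.
Qed.

Lemma matrix_unit_adj i j (z : R[i]) :
  op_adj (z *: matrix_unit i j) = conjc z *: matrix_unit j i.
Proof.
apply/funext => s; apply/funext => t.
rewrite /op_adj -[RHS]/(conjc z * _) -[LHS]/(conjc (z * _)) rmorphM.
by congr (_ * _); rewrite /matrix_unit andbC; exact: conjc_nat.
Qed.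

Lemma Sp_matrix_unit (p : R) (z : R[i]) i j : 0 < p -> `|z| = 1 ->
  Sp p (z *: matrix_unit i j).
Proof.
move=> p0 z1; split.
  apply: (@sparse_bounded _ _ 1 _ 1) => //.
    exact/sparseZ/matrix_unit_sparse.
  move=> k l; rewrite -[(_ *: _) k l]/(z * _) normrM z1 mul1r /matrix_unit.
  by case: (_ && _); rewrite ?normr1 ?normr0// ler01.
have PP : sparse_projection 1 (matrix_unit j j).
  split; [exact: matrix_unit_sparse| |exact: matrix_unit_mul].
  by rewrite -[matrix_unit j j in LHS]scale1r matrix_unit_adj rmorph1 scale1r.
rewrite (Lp_norm_projection _ (s := 1) PP)//; last 2 first.
- by move=> _; exists j; rewrite /matrix_unit eqxx oner_neq0.
- rewrite matrix_unit_adj (op_mulZ _ _ _ (matrix_unit_sparse j i)).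
  by rewrite matrix_unit_mul mulrC -sqr_normc z1 expr1n.
apply: poweR_lty; rewrite (esum_seq_supp (l := [:: j]))// ?ltry// => k.
  move=> _; rewrite inE /matrix_unit; case: (k == j) => //=.
  by rewrite mulr0 eqxx.
by rewrite powR1 mul1r /matrix_unit; case: (_ && _); rewrite //= ler01.
Qed.

End MatrixUnits.

Section Membership.
Variables (R : realType) (G : groupType).

Lemma sparse_tens (I J : choiceType) N M (x : I -> I -> R[i])
    (y : J -> J -> R[i]) :
  sparse N x -> sparse M y -> sparse (N * M) (tens x y).
Proof.
have few f g : few_nonzero N f -> few_nonzero M g ->
    few_nonzero (N * M) (fun k : I * J => f k.1 * g k.2 : R[i]).
  move=> [s [us sN fs]] [t [ut tM gt]].
  exists [seq (i, j) | i <- s, j <- t]; split.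
  - by apply: allpairs_uniq => // -[? ?] [? ?].
  - by rewrite size_allpairs leq_mul.
  move=> [i j]; rewrite mulf_eq0 negb_or => /andP[/fs si /gt tj].
  by apply/allpairsP; exists (i, j).
move=> [xr xc] [yr yc]; split=> -[i j]; first exact: few (xr i) (yr j).
exact: few (xc i) (yc j).
Qed.

Lemma sparse_lambda (g : G) : sparse 1 (lambda R g).
Proof.
split=> h.
  exists [:: (g^-1 * h)%g]; split=> // k; rewrite inE /lambda.
  by have [->|_] := eqVneq h (g * k)%g; rewrite ?mulKg eqxx.
exists [:: (g * h)%g]; split=> // k; rewrite inE /lambda.
by case: (k == _) => //=; rewrite eqxx.
Qed.

(** In this lemma and the next one, membership in a bicommutant only uses that
    its generators commute with the commutant by definition. *)
Lemma Linfty_lambda (g : G) : Linfty (lambda R g).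
Proof.
split=> [|y [_ yg]]; last by rewrite yg//; exists g.
apply: (@sparse_bounded _ _ 1 _ 1) => //; first exact: sparse_lambda.
by move=> i j; rewrite /lambda; case: (_ == _); rewrite ?normr1 ?normr0// ler01.
Qed.

Lemma vN_tens_sum N (F : seq G) (c : G -> nat -> nat -> R[i]) :
  (forall g, g \in F -> sparse N (c g) /\ bounded_op (c g)) ->
  bounded_op (\sum_(g <- F) tens (c g) (lambda R g)) ->
  vN_tens (@bounded_op R nat) (@Linfty R G)
    (\sum_(g <- F) tens (c g) (lambda R g)).
Proof.
move=> cF bS; split=> // y [_ yS].
apply: (@commute_sum _ _ _ (N * 1)) => g /cF[cs cb].
  exact: (sparse_tens cs (sparse_lambda g)).
rewrite yS//; exists (c g) => //; exists (lambda R g) => //.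
exact: Linfty_lambda.
Qed.

End Membership.

(** * Unconditionality constants and unimodular matrices *)

Section Grid.
Variables (R : realType) (G : groupType) (L : set G).
Variables (r c : nat -> G) (n : nat).
Hypothesis rcL : forall i j, (i < n)%N -> (j < n)%N -> L (r i * c j)%g.
Hypothesis rc_inj : forall i j i' j',
  (i < n)%N -> (j < n)%N -> (i' < n)%N -> (j' < n)%N ->
  (r i * c j = r i' * c j')%g -> i = i' /\ j = j'.
Implicit Types (a b : nat -> nat -> R[i]) (p D : R).

(** The operator sum_ij a_ij E_ij (x) lambda_(r_i c_j) (i, j < n). *)
Definition grid_op a := group_mx (fun i => (r i)^-1)%g c n a.

Definition grid_coef a (g : G) : nat -> nat -> R[i] :=
  fun i j => a i j *+ [&& (i < n)%N, (j < n)%N & r i * c j == g]%g.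

Definition grid : {fset G} :=
  [fset g in [seq (r i * c j)%g | i <- iota 0 n, j <- iota 0 n]]%fset.

Lemma gridP g :
  reflect (exists i j, [/\ (i < n)%N, (j < n)%N & g = (r i * c j)%g])
    (g \in grid).
Proof.
rewrite inE; apply: (iffP allpairsP) => [[[i j] /=]|[i [j [i_n j_n ->]]]].
  by rewrite !mem_iota => -[i_n j_n ->]; exists i, j.
by exists (i, j); rewrite !mem_iota.
Qed.

Lemma grid_op_sum a (eps : G -> R[i]) :
  \sum_(g <- grid) tens (grid_coef a g) (eps g *: lambda R g) =
  grid_op (fun i j => eps (r i * c j)%g * a i j).
Proof.
apply/funext => -[i x]; apply/funext => -[j y]; rewrite !fct_sumE.
rewrite /grid_op /group_mx /=.
have E g : tens (grid_coef a g) (eps g *: lambda R g) (i, x) (j, y) =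
    grid_coef a g i j * (eps g * (x == g * y)%g%:R) by [].
under eq_bigr do rewrite E.
have [i_n|i_n] := ltnP i n; last first.
  rewrite /= mulr0n big1// => g _.
  by rewrite /grid_coef ltnNge i_n /= mulr0n mul0r.
have [j_n|j_n] := ltnP j n; last first.
  rewrite /= mulr0n big1// => g _.
  by rewrite /grid_coef (ltnNge j) j_n /= andbF mulr0n mul0r.
rewrite (bigD1_seq (r i * c j)%g) ?fset_uniq//=; last first.
  by apply/gridP; exists i, j.
rewrite big1 ?addr0 => [|g /negPf gn]; last first.
  by rewrite /grid_coef (eq_sym _ g) gn !andbF mulr0n mul0r.
rewrite /grid_coef i_n j_n eqxx mulr1n mulrCA mulrA mulr_natr.
congr (_ *+ nat_of_bool _).
by rewrite -(inj_eq (@mulgI _ (r i))) mulVKg mulgA.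
Qed.

Lemma grid_op_sum1 a :
  \sum_(g <- grid) tens (grid_coef a g) (lambda R g) = grid_op a.
Proof.
rewrite (eq_bigr (fun g => tens (grid_coef a g) (1 *: lambda R g))).
  rewrite (grid_op_sum _ (fun=> 1)).
  by apply: eq_group_mx => i j _ _; rewrite mul1r.
by move=> g _; rewrite scale1r.
Qed.

Lemma fourier_coef_grid_op a g :
  fourier_coef (fun=> grid_op a) g = grid_coef a g.
Proof.
apply/funext => i; apply/funext => j.
rewrite /fourier_coef lim_cst; last exact: norm_hausdorff.
rewrite /grid_op /group_mx /grid_coef /= mulg1.
congr (_ *+ nat_of_bool [&& _, _ & _]).
by rewrite -(inj_eq (@mulgI _ (r i))) mulVKg eq_sym.
Qed.

(** This is where the products r_i c_j have to be different: each Fourier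
    coefficient is a multiple of a single matrix unit. *)
Lemma grid_coef_matrix_unit a i j : (i < n)%N -> (j < n)%N ->
  grid_coef a (r i * c j)%g = a i j *: matrix_unit R i j.
Proof.
move=> i_n j_n; apply/funext => k; apply/funext => l.
rewrite -[RHS]/(a i j * _) /grid_coef /matrix_unit mulr_natr.
have [/andP[/eqP -> /eqP ->]|kl] := boolP ((k == i) && (l == j)).
  by rewrite i_n j_n eqxx.
case: and3P => [[k_n l_n /eqP e]|_]; last by rewrite !mulr0n.
by have [ki lj] := rc_inj k_n l_n i_n j_n e; rewrite ki lj !eqxx in kl.
Qed.

Lemma grid_op_vN a : (forall i j, `|a i j| = 1) ->
  vN_tens (@bounded_op R nat) (@Linfty R G) (grid_op a).
Proof.
move=> a1; rewrite -grid_op_sum1; apply: (@vN_tens_sum _ _ 1).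
  move=> g /gridP[i [j [i_n j_n ->]]]; rewrite grid_coef_matrix_unit//; split.
    exact/sparseZ/matrix_unit_sparse.
  by have [] := @Sp_matrix_unit R 1 (a i j) i j ltr01 (a1 i j).
rewrite grid_op_sum1; apply: (@sparse_bounded _ _ n _ 1) => //.
  exact: group_mx_sparse.
by move=> s t; rewrite /grid_op /group_mx; case: [&& _, _ & _];
  rewrite ?mulr1n ?mulr0n ?a1 ?normr0 ?ler01.
Qed.

(** An operator of finite p-norm is represented in L^p by the constant
    sequence. *)
Lemma grid_op_Lp_sub p a (A : R) : 0 < p -> (forall i j, `|a i j| = 1) ->
  tr_tau_norm p (grid_op a) = A%:E -> Lp_sub p L (fun=> grid_op a).
Proof.
move=> p0 a1 aA; split.
  split=> [_|e e0]; first by split; [exact: grid_op_vN|rewrite aA ltry].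
  by exists 0%N => k l _ _; rewrite subrr /tr_tau_norm Lp_norm0.
move=> e e0; exists (grid_op a).
  exists grid, (grid_coef a); split; last by rewrite grid_op_sum1.
  move=> g /gridP[i [j [i_n j_n ->]]]; split; first exact: rcL.
  by rewrite grid_coef_matrix_unit//; exact: Sp_matrix_unit.
by near=> k; rewrite subrr /tr_tau_norm Lp_norm0// lee_fin ltW.
Unshelve. all: by end_near. Qed.

(** The unimodular factors b_ij / a_ij on the entries are unimodular factors on
    the Fourier coefficients because (i, j) is determined by r_i c_j. *)
Lemma uncond_bound_grid_op p D a b (A : R) : 0 < p -> uncond_bound p L D ->
  (forall i j, `|a i j| = 1) -> (forall i j, `|b i j| = 1) ->
  tr_tau_norm p (grid_op a) = A%:E ->
  (tr_tau_norm p (grid_op b) <= (D * A)%:E)%E.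
Proof.
move=> p0 LD a1 b1 aA.
have /choice[eps epsP] : forall g, exists e : R[i], `|e| = 1 /\
    forall i j, (i < n)%N -> (j < n)%N ->
      g = (r i * c j)%g -> e = b i j / a i j.
  move=> g; have [/gridP[i [j [i_n j_n ->]]]|gF] := boolP (g \in grid).
    exists (b i j / a i j); rewrite normf_div b1 a1 divr1.
    split=> // i' j' i'n j'n e.
    by have [-> ->] := rc_inj i_n j_n i'n j'n e.
  exists 1; split; rewrite ?normr1// => i j i_n j_n e.
  by move/negP: gF; case; apply/gridP; exists i, j.
have := LD (fun=> grid_op a) grid eps (grid_op_Lp_sub p0 a1 aA) _
  (fun g => (epsP g).1).
rewrite (eq_bigr _ (fun g _ =>
  congr1 (fun x => tens x _) (fourier_coef_grid_op a g))).
rewrite grid_op_sum /Lp_elt_norm lim_cst ?aA//.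
have -> : grid_op (fun i j => eps (r i * c j)%g * a i j) = grid_op b.
  apply: eq_group_mx => i j i_n j_n; rewrite ((epsP _).2 i j)// divfK//.
  by rewrite -normr_gt0 a1.
by apply => g /gridP[i [j [i_n j_n ->]]]; exact: rcL.
Qed.

End Grid.

Section LowerBound.
Variables (R : realType) (G : groupType).
Implicit Types (p D : R) (r c : nat -> G).

(** The matrix J of ones satisfies J^* J = n^2 (J / n), where J / n is the
    projection onto the constant vectors. *)
Lemma grid_op_ones_norm r c n p : (0 < n)%N -> 0 < p ->
  tr_tau_norm p (grid_op r c n (fun _ _ => 1 : R[i])) = n%:R%:E.
Proof.
move=> n0 p0; have nn0 : n%:R != 0 :> R[i] by rewrite pnatr_eq0 -lt0n.
rewrite (@group_mx_norm _ _ _ _ _ _ (fun _ _ => n%:R^-1) (n%:R ^+ 2) p 0)//.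
- rewrite sumr_const_nat subn0 -[X in complex.Re X]mulr_natl divff// mulr1.
  rewrite -powR_mulrn// -!powRrM; congr _%:E.
  by rewrite (_ : _ * _ = 1) ?powRr1//; field; rewrite lt0r_neq0.
- move=> i j _ _; rewrite -[X in X * 1]/(conjc 1) conjc1 mulr1.
  by rewrite sumr_const_nat subn0 rmorphXn rmorph_nat expr2 mulfK.
- move=> i j _ _; rewrite sumr_const_nat subn0 -[LHS]mulr_natl mulrA divff//.
  exact: mul1r.
- by move=> i j _ _; exact: (etrans (conjc_inv _) (congr1 _ (conjc_nat _ _))).
- by rewrite invr_neq0.
Qed.

Lemma grid_op_fourier_norm r c n p w : (0 < n)%N -> 0 < p ->
  (forall i j, (i < n)%N -> (j < n)%N ->
     \sum_(0 <= k < n) (w k i)^* * w k j = n%:R * (i == j)%:R :> R[i]) ->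
  tr_tau_norm p (grid_op r c n w) = (n%:R `^ (2^-1 + p^-1))%:E.
Proof.
move=> n0 p0 wn.
rewrite (@group_mx_norm _ _ _ _ _ _ (fun i j => (i == j)%:R) n%:R p 0)//.
- under eq_bigr do rewrite eqxx.
  rewrite sumr_const_nat subn0; congr _%:E.
  have -> : complex.Re (1 *+ n : R[i]) = n%:R.
    by rewrite -(rmorph_nat (real_complex R)).
  have p_neq0 : p != 0 by rewrite lt0r_neq0.
  have pp : p / 2 * p^-1 = 2^-1 by field.
  by rewrite powRM ?powR_ge0// -powRrM pp powRD// pnatr_eq0 -lt0n n0 implybT.
- by move=> i j i_n j_n; rewrite wn// rmorph_nat.
- move=> i j i_n j_n.
  rewrite (bigD1_seq i) ?iota_uniq ?mem_index_iota//= eqxx mul1r.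
  by rewrite big1 ?addr0// => k /negPf; rewrite eq_sym => ->; rewrite mul0r.
- by move=> i j _ _; rewrite eq_sym; exact: conjc_nat.
- exact: oner_neq0.
Qed.

(** The multiplier is applied to the matrix of smaller norm: the Fourier matrix
    if p >= 2, the matrix of ones if p < 2. *)
Lemma uncond_bound_ge (L : set G) r c n p D : (0 < n)%N -> 1 <= p ->
  (forall i j, (i < n)%N -> (j < n)%N -> L (r i * c j)%g) ->
  (forall i j i' j', (i < n)%N -> (j < n)%N -> (i' < n)%N -> (j' < n)%N ->
    (r i * c j = r i' * c j')%g -> i = i' /\ j = j') ->
  uncond_bound p L D -> n%:R `^ `|2^-1 - p^-1| <= D.
Proof.
move=> n0 p1 rcL rc_inj LD; have p0 : 0 < p by rewrite (lt_le_trans ltr01).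
have [w [w1 wn]] := @fourier_matrix_exists R n n0.
have one1 (i j : nat) : `|1 : R[i]| = 1 by exact: normr1.
have Jn := grid_op_ones_norm r c n0 p0.
have Wn := grid_op_fourier_norm r c n0 p0 wn.
have n0' : 0 < n%:R :> R by rewrite ltr0n.
have n_neq0 (t : R) : (t == 0) ==> (n%:R != 0 :> R).
  by rewrite lt0r_neq0 ?implybT.
have nE : n%:R = n%:R `^ (2^-1 + p^-1) * n%:R `^ (2^-1 - p^-1) :> R.
  by rewrite -powRD// (_ : 2^-1 + p^-1 + _ = 1) ?powRr1 ?(ltW n0')//; lra.
have [pq|pq] := leP 0 (2^-1 - p^-1).
  have := uncond_bound_grid_op rcL rc_inj p0 LD w1 one1 Wn.
  rewrite Jn lee_fin ger0_norm// [leLHS]nE [leLHS]mulrC.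
  by rewrite ler_pM2r// powR_gt0.
have := uncond_bound_grid_op rcL rc_inj p0 LD one1 w1 Jn.
rewrite Wn lee_fin ltr0_norm//.
rewrite (_ : 2^-1 + p^-1 = - (2^-1 - p^-1) + 1); last by lra.
by rewrite powRD// powRr1 ?(ltW n0')// ler_pM2r.
Qed.

End LowerBound.

(** * Sumsets without coincidences *)

Section Sumsets.
Variable G : groupType.

Lemma card_le_injseq N (A : set G) : (`I_N #<= A)%card ->
  exists r : nat -> G,
  (forall k, (k < N)%N -> A (r k)) /\
  (forall k l, (k < N)%N -> (l < N)%N -> r k = r l -> k = l).
Proof.
move=> /card_leP[f].
have e k : (k < N)%N -> exists z : `I_N, \val z = k.
  by move=> kN; have kI : k \in `I_N by [rewrite inE]; exists (SigSub kI).
pose r k := if insub k is Some z then \val (f z) else 1%g.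
have rE (z : `I_N) : r (\val z) = \val (f z) by rewrite /r valK.
exists r; split=> [k /e[z <-]|k l /e[z <-] /e[z' <-]]; rewrite !rE.
  exact/set_mem/valP.
by move=> /val_inj h; congr \val; apply: (@inj _ _ _ f) => //; rewrite inE.
Qed.

Definition disjoint_translates (r : nat -> G) n (x y : G) :=
  all (fun i => all (fun i' => r i * x != r i' * y)%g (iota 0 n)) (iota 0 n).

(** An element x violates the condition for a given y only if
    x = r_i^-1 r_i' y for some i and i', so that k < n elements y exclude at
    most k n^2 < n^3 elements x. *)
Lemma disjoint_translates_exist (r : nat -> G) n (C : set G) :
  (`I_(n ^ 3) #<= C)%card ->
  exists c : nat -> G, (forall j, (j < n)%N -> C (c j)) /\
    (forall j j', (j < j' < n)%N -> disjoint_translates r n (c j) (c j')).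
Proof.
move=> /card_le_injseq[c0 [c0C c0_inj]].
suff [s [sn sC sP]] : exists s : seq G,
    [/\ size s = n, forall x, x \in s -> C x &
       pairwise (fun y x => disjoint_translates r n x y) s].
  exists (nth 1%g (rev s)); split=> [j jn|j j' /andP[jj' j'n]].
    by apply/sC; rewrite -mem_rev mem_nth// size_rev sn.
  have jn := ltn_trans jj' j'n.
  rewrite !nth_rev ?sn//; move/(pairwiseP 1%g): sP; apply; rewrite ?inE ?sn.
  - by rewrite ltn_subLR ?addSn ?ltnS ?leq_addl// (leq_ltn_trans _ j'n).
  - by rewrite ltn_subLR ?addSn ?ltnS ?leq_addl// (leq_ltn_trans _ j'n).
  - by apply: ltn_sub2l => //; exact: leq_ltn_trans jj' j'n.
have : (n <= n)%N by [].
elim: {1 3}n => [|k IH] kn; first by exists [::].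
have [s [sk sC sP]] := IH (ltnW kn).
pose bad := [seq ((r ii'.1)^-1 * (r ii'.2 * y))%g | y <- s,
  ii' <- [seq (i, i') | i <- iota 0 n, i' <- iota 0 n]].
pose cand := [seq c0 l | l <- iota 0 (n ^ 3)].
have [x xc xb] : exists2 x, x \in cand & x \notin bad.
  apply/hasP; apply/negPn/negP; rewrite -all_predC => /allP h.
  have : (size cand <= size bad)%N.
    apply: uniq_leq_size.
      rewrite map_inj_in_uniq ?iota_uniq// => l l'.
      rewrite !mem_iota; exact: c0_inj.
    by move=> x /h /=; rewrite negbK.
  rewrite size_map size_iota !size_allpairs !size_iota sk leqNgt.
  move=> /negP; apply.
  by rewrite !expnS expn0 muln1 ltn_pmul2r// muln_gt0 (leq_ltn_trans _ kn).
exists (x :: s); split=> /=; first by rewrite sk.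
  move=> y; rewrite inE => /predU1P[->|/sC//].
  by have /mapP[l ln ->] := xc; apply: c0C; rewrite mem_iota in ln.
rewrite sP andbT; apply/allP => y ys.
apply/allP => i i_n; apply/allP => i' i'_n.
apply: contra xb => /eqP e; apply/allpairsP; exists (y, (i', i)); split=> //=.
  by apply/allpairsP; exists (i', i).
by rewrite e mulKg.
Qed.

Lemma sumset_grid n (A C : set G) :
  (`I_n #<= A)%card -> (`I_(n ^ 3) #<= C)%card ->
  exists r c : nat -> G,
    (forall i j, (i < n)%N -> (j < n)%N -> sumset A C (r i * c j)%g) /\
    (forall i j i' j', (i < n)%N -> (j < n)%N -> (i' < n)%N -> (j' < n)%N ->
       (r i * c j = r i' * c j')%g -> i = i' /\ j = j').
Proof.
move=> /card_le_injseq[r [rA r_inj]] /(disjoint_translates_exist r)[c [cC cP]].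
exists r, c; split=> [i j i_n j_n|i j i' j' i_n j_n i'n j'n e].
  by exists (r i); [exact: rA|exists (c j) => //; exact: cC].
have disj k l a b : (k < l < n)%N -> (a < n)%N -> (b < n)%N ->
    (r a * c k)%g <> (r b * c l)%g.
  move=> kl an bn.
  have /allP/(_ a) := cP _ _ kl; rewrite mem_iota an => /(_ isT).
  by move=> /allP/(_ b); rewrite mem_iota bn => /(_ isT)/eqP.
have [jj'|jj'|jj'] := ltngtP j j'.
- by case: (disj j j' i i'); rewrite ?jj'.
- by case: (disj j' j i' i); rewrite ?jj'.
by split=> //; apply: r_inj => //; rewrite jj' in e; exact: (@mulIg _ _ _ _ e).
Qed.

End Sumsets.

Local Close Scope complex_scope.

Theorem proposition4p8 (K : realType) (G : groupType) :
  (forall (p : K) (L : set G), 1 <= p -> p <> 2 ->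
     completely_unconditional p L ->
     exists N : nat, forall R C : set G,
       (`I_N #<= R)%card -> (`I_N #<= C)%card -> ~ (sumset R C `<=` L)) /\
  (forall (n : nat) (R C : set G), (1 <= n)%N ->
     (`I_n #<= R)%card -> (`I_(n ^ 3) #<= C)%card ->
     forall p : K, 1 <= p ->
       ((n%:R `^ `|2^-1 - p^-1|)%R%:E
          <= complete_unconditional_constant p (sumset R C))%E).
Proof.
split=> [p L p1 p2 [D LD]|n A C n0 An Cn p p1]; last first.
  have [r [c [rcL rc_inj]]] := sumset_grid An Cn.
  apply: le_ereal_inf_tmp => _ [D [_ LD] <-]; rewrite lee_fin.
  exact: (uncond_bound_ge n0 p1 rcL rc_inj LD).
have p0 : p != 0 by rewrite lt0r_neq0// (lt_le_trans ltr01).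
pose t : K := `|2^-1 - p^-1|.
have t0 : 0 < t.
  rewrite normr_gt0 subr_eq0; apply/eqP => e; apply: p2.
  by rewrite -[p]invrK -e invrK.
have [n n0 nD] : exists2 n, (0 < n)%N & D < n%:R `^ t.
  pose x : K := `|D| + 1; have x0 : 0 < x by rewrite ltr_wpDl.
  pose y : K := x `^ t^-1.
  have yt : y `^ t = x by rewrite -powRrM mulVf ?lt0r_neq0// powRr1// ltW.
  exists (Num.truncn y).+1 => //.
  apply: (@lt_trans _ _ x); first by rewrite (le_lt_trans (ler_norm D))// ltrDl.
  by rewrite -yt gt0_ltr_powR ?nnegrE ?powR_ge0//; exact: truncnS_gt.
exists (n ^ 3)%N => A C An Cn ACL.
have {}An : (`I_n #<= A)%card.
  apply: card_le_trans An; apply: subset_card_le => k /= kn.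
  by rewrite (leq_trans kn)// -[leqLHS]expn1 leq_pexp2l.
have [r [c [rcL rc_inj]]] := sumset_grid An Cn.
have rcL' i j i_n j_n := ACL _ (rcL i j i_n j_n).
have := uncond_bound_ge n0 p1 rcL' rc_inj LD.
by rewrite leNgt nD.
Qed.
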